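(* The pair $(\{\mathcal{K}_k(x;y)\}_{k=0}^\infty,\{1\}_{k=0}^\infty)$ is a palindromic pair with degree $n$. Namely, let $n\in\mathbb{Z}_{\ge0}$ and $s\in\mathscr{S}_{n+1}(\mathcal{K};n)=\{s\in\mathbb{C}:\mathcal{K}_{n+1}(s;n)=0\}$. Then $\mathcal{K}_k(s;n)=0$ for $k\ge n+1$, and $$\mathcal{K}_k(s;n)=(-1)^s\,\mathcal{K}_{n-k}(s;n)\qquad\text{for } k\le n.$$ In particular, $\mathcal{K}_n(s;n)=(-1)^s$ for $s\in\mathscr{S}_{n+1}(\mathcal{K};n)$.
   Context: Palindromic pairs. Let $\{p_k(x;y)\}_{k=0}^\infty$ be a sequence of polynomials in two variables with $p_0(x;y)=1$, $\{a_k\}_{k=0}^\infty$ a sequence of non-zero numbers, and $d\colon\mathbb{Z}_{\ge0}\to\mathbb{R}$ a map. For $n\in\mathbb{Z}_{\ge0}$ put $\mathscr{S}_k(p;n)=\{s\in\mathbb{C}:p_k(s;n)=0\}$. The pair $(\{p_k\},\{a_k\})$ is a palindromic pair with degree $d(n)$ if, for each $n\in\mathbb{Z}_{\ge 0}$ with $d(n)\in\mathbb{Z}_{\ge0}$, there exists a map $\theta_{(p;n)}\colon\mathscr{S}_{d(n)+1}(p;n)\to\{\pm1\}$ such that for all $s\in\mathscr{S}_{d(n)+1}(p;n)$ we have $p_k(s;n)=0$ for $k\ge d(n)+1$ and $\frac{p_k(s;n)}{a_k}=\theta_{(p;n)}(s)\frac{p_{d(n)-k}(s;n)}{a_{d(n)-k}}$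 for $0\le k\le d(n)$. Krawtchouk polynomials: $\mathcal{K}_k(x;y)=\sum_{j=0}^k(-1)^j\binom{x}{j}\binom{y-x}{k-j}$ for $k\in\mathbb{Z}_{\ge0}$, where $\binom{u}{m}=\frac{u(u-1)\cdots(u-m+1)}{m!}$ for $m\ge1$ and $\binom u0=1$. $\{1\}_{k=0}^\infty$ is the constant sequence $a_k=1$. One has $\mathscr{S}_{n+1}(\mathcal{K};n)=\{0,1,\ldots,n\}$, so $(-1)^s$ makes sense. *)

(* Defs.v *)
From mathcomp Require Import all_boot all_order all_algebra.
From mathcomp Require Import polyXY complex.
From mathcomp Require Import classical_sets functions reals.

Set Implicit Arguments.
Unset Strict Implicit.
Unset Printing Implicit Defensive.

Import GRing.Theory Num.Theory.
Local Open Scope classical_set_scope.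
Local Open Scope ring_scope.

(* It is used both in the field of complex numbers and in bivariate
   polynomials over it; in both rings m`!%:R is a unit, so that dividing by it
   is genuine division. *)
Definition gbinom (A : unitRingType) (u : A) (m : nat) : A :=
  (\prod_(i < m) (u - i%:R)) / m`!%:R.

(* In {poly {poly C}} the outer variable 'X is x and 'Y = 'X%:P is y;
   p.[s, t] evaluates p at x = s and y = t. *)
Definition Krawtchouk (R : realType) (k : nat) : {poly {poly R[i]}} :=
  \sum_(j < k.+1) (-1) ^+ j * gbinom 'X j * gbinom ('Y - 'X) (k - j).

Definition zeros (R : realType) (p : nat -> {poly {poly R[i]}}) (k n : nat) :
    set R[i] :=
  [set s | (p k).[s, n%:R] = 0].

Definition palindromic_pair (R : realType) (p : nat -> {poly {poly R[i]}})
    (a : nat -> R[i]) (d : nat -> R) : Prop :=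
  [/\ p 0%N = 1,
      forall k, a k != 0
    & forall n m : nat, d n = m%:R ->
      exists theta : R[i] -> R[i],
        set_fun (zeros p m.+1 n) [set 1; -1] theta /\
        forall s, zeros p m.+1 n s ->
          (forall k, (m.+1 <= k)%N -> (p k).[s, n%:R] = 0) /\
          (forall k, (k <= m)%N ->
             (p k).[s, n%:R] / a k
             = theta s * ((p (m - k)%N).[s, n%:R] / a (m - k)%N))].

Lemma gbinom_eval (R : realType) (u : {poly {poly R[i]}}) (m : nat)
    (s t : R[i]) : (gbinom u m).[s, t] = gbinom u.[s, t] m.
Proof.
have fact_unit : (m`!%:R : R[i]) \is a GRing.unit.
  by rewrite unitfE pnatr_eq0 -lt0n fact_gt0.
have fE : (m`!%:R : {poly {poly R[i]}})^-1 = ((m`!%:R : R[i])^-1)%:P%:P.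
  apply/esym; rewrite -[LHS]/((polyC \o polyC) _) rmorphV //=.
  by rewrite !polyC_natr.
rewrite /gbinom fE !hornerM !hornerC; congr (_ / _).
rewrite !horner_prod; apply: eq_bigr => i _.
by rewrite -!polyC_natr !(hornerD, hornerN, hornerC).
Qed.

Lemma Krawtchouk_eval (R : realType) (k : nat) (s t : R[i]) :
  (Krawtchouk R k).[s, t] =
  \sum_(j < k.+1) (-1) ^+ j * gbinom s j * gbinom (t - s) (k - j).
Proof.
rewrite /Krawtchouk !horner_sum; apply: eq_bigr => j _.
rewrite 4!hornerM !gbinom_eval !(horner_exp, hornerN, hornerD, hornerC, hornerX).
by rewrite !hornerE.
Qed.

(* Main.v *)
Require Import Defs.
From mathcomp Require Import all_boot all_order all_algebra.
From mathcomp Require Import polyXY complex.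
From mathcomp Require Import classical_sets functions reals.
From mathcomp Require Import ring.

(** At an integer point the Krawtchouk values are the coefficients of a product
    of linear factors: for [0 <= m <= n],
      [\sum_k K_k(m; n) z^k = (1 - z)^m (1 + z)^(n - m)]
    ([Krawtchouk_nat]).  The right-hand side has degree [n], so
    [K_k(m; n) = 0] for [k > n]; and reversing its coefficients turns each
    factor [1 + c z] with [c = 1] or [c = -1] into [z + c = c (1 + c z)], so
    reversal multiplies the whole product by [(-1)^m].  This is the palindromic
    identity ([reciprocal_Krawtchouk_gen]).

    There are no zeros of [K_(n+1)(s; n)] besides [0, ..., n]: it is a
    polynomial in [s] of degree at most [n + 1] which vanishes at these [n + 1]
    points, and it is not the zero polynomial because its value at [s = -1] is
    [\sum_j 'C(n + 1, j) = 2^(n + 1)] ([zeros_Krawtchouk]).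

    The sign map of the palindromic pair can be taken to be
    [s |-> K_n(s; n)], whose value at [s = m] is [(-1)^m] by the identity at
    [k = n]. *)

Set Implicit Arguments.
Unset Strict Implicit.
Unset Printing Implicit Defensive.

Import GRing.Theory Num.Theory.
Local Open Scope classical_set_scope.
Local Open Scope ring_scope.

(** * Reciprocal polynomials *)

(** [q = e z^n q(1/z)], with [q] of degree at most [n]; the formal degree [n]
    is a parameter because the palindrome is centred at [n / 2] even when the
    extreme coefficients vanish. *)
Definition reciprocal (A : comNzRingType) (e : A) (n : nat) (q : {poly A}) :=
  (forall k, (n < k)%N -> q`_k = 0) /\
  (forall k, (k <= n)%N -> q`_k = e * q`_(n - k)).

(** Reversing [1 + c z] gives [z + c = c (1 + c z)] when [c ^ 2 = 1], so such a
    factor contributes [c] to the sign. *)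
Lemma reciprocal_mul_linear (A : comNzRingType) (c e : A) n q :
  c * c = 1 -> reciprocal e n q ->
  reciprocal (e * c) n.+1 (q * (1 + c *: 'X)).
Proof.
move=> cc [q0 qe].
have qE k : (q * (1 + c *: 'X))`_k =
            q`_k + c * (if k is k'.+1 then q`_k' else 0).
  by rewrite mulrDr mulr1 -scalerAr coefD coefZ coefMX; case: k.
split=> -[|k] // lek; rewrite !qE.
- by rewrite !q0 ?mulr0 ?addr0 // ltnW.
- rewrite subn0 (q0 n.+1) // (qe 0%N) // subn0; ring: cc.
rewrite subSS (qe k) //.
have [ltkn|lenk] := ltnP k n.
  rewrite (qe k.+1) // -[in RHS](subnSK ltkn) -[(n - k)%N](subnSK ltkn).
  have -> a b : e * c * (b + c * a) = e * b * c + e * a * (c * c) by ring.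
  by rewrite cc; ring.
have -> : k = n by apply/eqP; rewrite eqn_leq -ltnS lek.
by rewrite subnn (q0 n.+1) //; ring.
Qed.

Lemma reciprocal_mul_linearX (A : comNzRingType) (c e : A) n q m :
  c * c = 1 -> reciprocal e n q ->
  reciprocal (e * c ^+ m) (n + m) (q * (1 + c *: 'X) ^+ m).
Proof.
move=> cc rq; elim: m => [|m IHm]; first by rewrite addn0 !expr0 !mulr1.
by rewrite addnS !exprSr !mulrA; apply: reciprocal_mul_linear.
Qed.

Definition Krawtchouk_gen (A : comNzRingType) (n m : nat) : {poly A} :=
  (1 + (-1) *: 'X) ^+ m * (1 + 1 *: 'X) ^+ (n - m).

Lemma reciprocal_Krawtchouk_gen (A : comNzRingType) n m : (m <= n)%N ->
  reciprocal ((-1) ^+ m) n (Krawtchouk_gen A n m).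
Proof.
move=> lemn.
have r1 : reciprocal (1 : A) 0 1.
  by split=> -[|k] // _; rewrite ?mul1r // coef1.
have cN : (-1 : A) * (-1) = 1 by rewrite mulrNN mulr1.
have := reciprocal_mul_linearX (n - m) (mulr1 1)
  (reciprocal_mul_linearX m cN r1).
by rewrite expr1n mulr1 !mul1r add0n subnKC.
Qed.

Lemma coef_linearX (A : comNzRingType) (c : A) m k :
  ((1 + c *: 'X) ^+ m)`_k = c ^+ k * 'C(m, k)%:R.
Proof.
have -> : (1 + c *: 'X) ^+ m = \poly_(i < m.+1) (c ^+ i * 'C(m, i)%:R).
  rewrite exprDn poly_def; apply: eq_bigr => i _.
  by rewrite expr1n mul1r exprZn mulr_natr -scalerMnl.
rewrite coef_poly ltnS; case: leqP => // ltmk.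
by rewrite bin_small // mulr0.
Qed.

(** * Generalized binomial coefficients *)

Lemma gbinom_nat (F : numFieldType) m j : gbinom (m%:R : F) j = 'C(m, j)%:R.
Proof.
have fact_neq0 : (j`!%:R : F) != 0 by rewrite pnatr_eq0 -lt0n fact_gt0.
apply: (mulIf fact_neq0); rewrite divfK // -natrM bin_ffact.
elim: j {fact_neq0} => [|j IHj]; first by rewrite big_ord0.
rewrite big_ord_recr /= IHj ffactnSr natrM.
have [lejm|ltmj] := leqP j m; first by rewrite natrB.
by rewrite ffact_small // !mul0r.
Qed.

Lemma gbinomN1 (F : numFieldType) j : gbinom (-1 : F) j = (-1) ^+ j.
Proof.
have fact_neq0 : (j`!%:R : F) != 0 by rewrite pnatr_eq0 -lt0n fact_gt0.
apply: (mulIf fact_neq0); rewrite divfK //.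
elim: j {fact_neq0} => [|j IHj]; first by rewrite big_ord0 mul1r.
rewrite big_ord_recr /= IHj factS natrM exprSr -natr1; ring.
Qed.

Lemma fact_polyV (F : numFieldType) m :
  (m`!%:R : {poly F})^-1 = (m`!%:R^-1)%:P.
Proof.
have fact_unit : (m`!%:R : F) \is a GRing.unit.
  by rewrite unitfE pnatr_eq0 -lt0n fact_gt0.
by rewrite -polyC_natr -rmorphV.
Qed.

Lemma horner_gbinom (F : numFieldType) (u : {poly F}) m s :
  (gbinom u m).[s] = gbinom u.[s] m.
Proof.
rewrite /gbinom fact_polyV hornerM hornerC horner_prod; congr (_ * _).
by apply: eq_bigr => i _; rewrite -polyC_natr hornerD hornerN hornerC.
Qed.

Lemma size_gbinom (F : numFieldType) (u : {poly F}) m :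
  (size u <= 2)%N -> (size (gbinom u m) <= m.+1)%N.
Proof.
move=> su; rewrite /gbinom fact_polyV mulrC mul_polyC.
apply: leq_trans (size_scale_leq _ _) _.
elim: m => [|m IHm]; first by rewrite big_ord0 size_poly1.
rewrite big_ord_recr /=; apply: leq_trans (size_polyMleq _ _) _.
have sv : (size (u - m%:R)%R <= 2)%N.
  apply: leq_trans (size_polyD _ _) _; rewrite geq_max su size_polyN.
  by rewrite -polyC_natr (leq_trans (size_polyC_leq1 _)).
by rewrite -subn1 leq_subLR add1n (leq_trans (leq_add IHm sv)) // addn2.
Qed.

(** * The zeros and the values of Krawtchouk polynomials *)

Lemma Krawtchouk_nat (R : realType) k n m : (m <= n)%N ->
  (Krawtchouk R k).[m%:R, n%:R] = (Krawtchouk_gen R[i] n m)`_k.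
Proof.
move=> lemn; rewrite Krawtchouk_eval coefM; apply: eq_bigr => j _.
by rewrite -natrB // !gbinom_nat !coef_linearX expr1n mul1r.
Qed.

Lemma reciprocal_Krawtchouk (R : realType) n m : (m <= n)%N ->
  (forall k, (n < k)%N -> (Krawtchouk R k).[m%:R, n%:R] = 0) /\
  (forall k, (k <= n)%N -> (Krawtchouk R k).[m%:R, n%:R] =
     (-1) ^+ m * (Krawtchouk R (n - k)).[m%:R, n%:R]).
Proof.
move=> lemn; have [g0 ge] := reciprocal_Krawtchouk_gen R[i] lemn.
by split=> k; rewrite !Krawtchouk_nat //; [apply: g0 | apply: ge].
Qed.

Lemma Krawtchouk0 (R : realType) : Krawtchouk R 0 = 1.
Proof.
by rewrite /Krawtchouk big_ord1 /gbinom !big_ord0 fact0 invr1 expr0 !mulr1.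
Qed.

(** [K_k(s; n)] as a polynomial in [s] with [n] fixed, so that its roots can be
    counted. *)
Lemma Krawtchouk_poly (R : realType) k n :
  {P : {poly R[i]} | (size P <= k.+1)%N &
    forall s, P.[s] = (Krawtchouk R k).[s, n%:R]}.
Proof.
exists (\sum_(j < k.+1) (-1) ^+ j * gbinom 'X j * gbinom (n%:R - 'X) (k - j)).
  apply: (leq_trans (size_sum _ _ _)); apply/bigmax_leqP => j _.
  rewrite -mulrA -signr_odd mulr_sign.
  set Q := _ * _; suff sQ : (size Q <= k.+1)%N.
    by case: odd; rewrite ?size_polyN.
  have lejk : (j <= k)%N by rewrite -ltnS.
  apply: leq_trans (size_polyMleq _ _) _.
  rewrite -subn1 leq_subLR add1n.
  have -> : k.+2 = (j.+1 + (k - j).+1)%N by rewrite addSn addnS subnKC.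
  apply: leq_add; apply: size_gbinom; first by rewrite size_polyX.
  apply: leq_trans (size_polyD _ _) _; rewrite geq_max size_polyN size_polyX.
  by rewrite -polyC_natr (leq_trans (size_polyC_leq1 _)).
move=> s; rewrite Krawtchouk_eval horner_sum; apply: eq_bigr => j _.
rewrite 2!hornerM !horner_gbinom !(horner_exp, hornerD, hornerN, hornerX).
by rewrite -polyC_natr !hornerC.
Qed.

(** At [s = -1] the alternating signs cancel those of [gbinom (-1) j], leaving
    a full row of Pascal's triangle. *)
Lemma KrawtchoukN1 (R : realType) n :
  (Krawtchouk R n.+1).[-1, n%:R] = 2 ^+ n.+1.
Proof.
rewrite Krawtchouk_eval opprK natr1 -[2]/(1 + 1 : R[i]) exprDn.
apply: eq_bigr => j _.
rewrite gbinomN1 gbinom_nat -exprMn mulrNN mulr1 !expr1n mul1r mul1r.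
by rewrite bin_sub // -ltnS.
Qed.

(** A zero [s] outside [0, ..., n] would give a nonzero polynomial of degree at
    most [n + 1] a total of [n + 2] distinct roots. *)
Lemma zeros_Krawtchouk (R : realType) n :
  zeros (Krawtchouk R) n.+1 n = [set (m%:R : R[i]) | m in `I_n.+1].
Proof.
rewrite /zeros; apply/seteqP; split=> s /=; last first.
  case=> m /ltnSE lemn <-.
  by have [K0 _] := reciprocal_Krawtchouk R lemn; exact: K0.
move=> Ks0.
have [P sP PE] := Krawtchouk_poly R n.+1 n.
have P_neq0 : P != 0.
  apply: contra_neq (_ : (2 : R[i]) ^+ n.+1 != 0) => [P0|].
    by rewrite -KrawtchoukN1 -PE P0 horner0.
  by rewrite expf_neq0 // pnatr_eq0.
pose rs : seq R[i] := [seq m%:R | m <- iota 0 n.+1].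
have [/mapP[m]|s_notin] := boolP (s \in rs).
  by rewrite mem_iota => lemn ->; exists m.
have uniq_rs : uniq (s :: rs).
  rewrite cons_uniq s_notin map_inj_uniq ?iota_uniq // => a b /eqP.
  by rewrite eqr_nat => /eqP.
have root_rs : all (root P) (s :: rs).
  rewrite [all _ _]/(root P s && all (root P) rs) /root PE Ks0 eqxx.
  apply/allP => _ /mapP[m + ->].
  rewrite mem_iota ltnS PE => lemn.
  by have [K0 _] := reciprocal_Krawtchouk R lemn; apply/eqP/K0.
have := max_poly_roots P_neq0 root_rs uniq_rs.
by rewrite /= size_map size_iota ltnNge sP.
Qed.

(* (-1)^s is read through the natural number m with s = m%:R, which exists by
   the first conjunct on the zero set and is unique in characteristic 0. *)
Theorem theorem8p19 (R : realType) :
  palindromic_pair (Krawtchouk R) (fun=> 1) (fun n => n%:R) /\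
  forall n : nat,
    zeros (Krawtchouk R) n.+1 n = [set (m%:R : R[i]) | m in `I_n.+1] /\
    forall s : R[i], zeros (Krawtchouk R) n.+1 n s ->
      (forall k : nat, (n.+1 <= k)%N -> (Krawtchouk R k).[s, n%:R] = 0) /\
      forall m : nat, s = m%:R ->
        (forall k : nat, (k <= n)%N ->
           (Krawtchouk R k).[s, n%:R]
           = (-1) ^+ m * (Krawtchouk R (n - k)).[s, n%:R]) /\
        (Krawtchouk R n).[s, n%:R] = (-1) ^+ m.
Proof.
have K1 n m : (m <= n)%N -> (Krawtchouk R n).[m%:R, n%:R] = (-1) ^+ m.
  move=> lemn; rewrite (reciprocal_Krawtchouk R lemn).2 // subnn.
  by rewrite Krawtchouk0 !hornerE.
split; last first.
  move=> n; split=> [|s]; first exact: zeros_Krawtchouk.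
  rewrite zeros_Krawtchouk => -[m0 /ltnSE lemn <-] /=.
  have [K0 Kpal] := reciprocal_Krawtchouk R lemn.
  split=> // m /eqP; rewrite eqr_nat => /eqP <-.
  by split=> //; apply: K1.
split=> [|k|n m /eqP]; [exact: Krawtchouk0|exact: oner_neq0|].
rewrite eqr_nat => /eqP <- {m}.
exists (fun s => (Krawtchouk R n).[s, n%:R]); rewrite zeros_Krawtchouk.
split=> _ [m /ltnSE lemn <-] /=; rewrite K1 //.
  by rewrite -signr_odd; case: odd; [right|left].
have [K0 Kpal] := reciprocal_Krawtchouk R lemn.
by split=> // k lekn; rewrite !divr1; apply: Kpal.
Qed.
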